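(* Let $G=(V_G,E_G)$ be a finite directed graph with positive integer vertex weights $w(v)$ $(v\in V_G)$ satisfying $w(s)+w(t)>w(u)$ for all $s,t,u\in V_G$, with a total preorder $\precsim_v$ on the incoming edges of each $v \in V_G$, and let $D$ be the associated rooted digraph. If $D$ admits a popular arborescence, then the algorithm described in the context finds one, i.e. it returns an edge set $A^*$ which is a popular arborescence in $D$.
   Context: Setting. $D=(V,E)$ with $V=V_G\cup\{r\}$ ($r$ a new root vertex) and $E=E_G\cup\{(r,v):v\in V_G\}$. For non-empty $X\subseteq V_G$, $\delta^-(X)\subseteq E$ is the set of edges of $D$ entering $X$, $\delta^-(v)=\delta^-(\{v\})$, and $E[X]$ is the set of edges of $E$ with both ends in $X$. Each $v\in V_G$ has a total preorder $\precsim_v$ (transitive, reflexive, total) on $\delta^-(v)$; $e\precsim_v f$ (also $f\succsim_v e$) means $f$ has at least the priority of $e$; $e\sim_v f$ means $e\precsim_v f$ and $f\precsim_v e$; $e\prec_v f$ (also $f\succ_v e$; ''$f$ dominates $e$'') means $e\precsim_v f$ but not $f\precsim_v e$. The edge $(r,v)$ is strictly least preferred: every edge of $E_G\cap\delta^-(v)$ dominates $(r,v)$. Popularity. An $r$-arborescence in $D$ is a spanning out-tree rooted at $r$ (identified with its edge set); $A(v)$ is the edge of $A$ entering $v$. For $r$-arborescences $A,A'$, let $\Delta_w(A,A')=\sum_{v:A(v)\succ_v A'(v)}w(v)-\sum_{v:A'(v)\succ_v A(v)}w(v)$. $A$ is more popular than $A'$ if $\Delta_w(A,A')>0$; $A$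 is a popular arborescence if no $r$-arborescence is more popular than $A$. Safe edges. For $X\subseteq V_G$, an edge $(u,v)\in E[X]$ is safe in $X$ if (i) $(u,v)\succsim_v(u',v)$ for all $(u',v)\in E[X]$, and (ii) $(u,v)\succ_v(t,v)$ for all $(t,v)\in\delta^-(X)$. $S(X)$ is the set of safe edges in $X$. Algorithm. Step 1. For each $v\in V_G$: put $X_v^0=V_G$, $i=0$; while $v$ does not reach all vertices in $D_v^i=(X_v^i,S(X_v^i))$, let $X_v^{i+1}$ be the set of vertices reachable from $v$ in $D_v^i$ and increase $i$ by 1. At the end set $X_v=X_v^i$, $D_v=D_v^i=(X_v,S(X_v))$. Step 2. Let $\mathcal{X}=\{X_v:v\in V_G\}$ and let $\mathcal{X}'$ be the family of inclusion-wise maximal members of $\mathcal{X}$ (the family $\mathcal X$ is laminar, so the members of $\mathcal{X}'$ partition $V_G$). Put $E'=\emptyset$ and $D'=(\mathcal{X}'\cup\{r\},E')$. Step 3. For each $X_v\in\mathcal{X}'$: let $\bar X_v$ be the strongly connected component of $D_v$ that no edge of $S(X_v)$ enters. Say that a minimum-weight vertex $v'$ of $\bar X_v$ satisfies condition (C) if there exist $s\in X_v\setminus\bar X_v$ and $f\in(E[X_v]\setminus S(X_v))\cap\delta^-(v')$ such that: 1. $w(s)<w(v')$; 2. $v'$ is reachable from $s$ by edges in $S(X_v)\cup\{f\}$; 3. $f\succ_{v'}e$ for all $e\in\delta^-(v')\cap\delta^-(X_v)$. If every minimum-weight vertex of $\bar X_v$ satisfies (C), return ''No popular arborescence in $D$''.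 Otherwise, for every minimum-weight vertex $v'$ of $\bar X_v$ and every edge $e=(u,v')\in E$ with $u\notin X_v$ that is not dominated by any edge of $\delta^-(X_v)$, add to $E'$ an edge $e'$ corresponding to $e$, where $e'=(U,X_v)$ if $u\in U\in\mathcal{X}'$, and $e'=(r,X_v)$ if $u=r$ (distinct $e$ give distinct, possibly parallel, $e'$). Step 4. If $D'=(\mathcal{X}'\cup\{r\},E')$ contains no $r$-arborescence, return ''No popular arborescence in $D$''. Otherwise take an $r$-arborescence $A'$ in $D'$, let $\tilde A=\{e:e'\in A'\}$ and $R=\{v\in V_G:|X_v|\ge 2,\ \delta^-(v)\cap\tilde A\ne\emptyset\}$; for each $v\in R$ let $A_v$ be a $v$-arborescence (spanning out-tree rooted at $v$) in $(X_v,S(X_v))$; return $A^*=\tilde A\cup\bigcup_{v\in R}A_v$.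
   Formalization: Step 3 is corrected so that edges are added to E' only for minimum-weight vertices not satisfying (C); for Step 3 as worded it is shown only that ''No popular arborescence'' is never returned and that some choice of A' and the A_v gives a popular arborescence. *)

(* Defs.v *)
From mathcomp Require Import all_boot all_order all_algebra.

Set Implicit Arguments.
Unset Strict Implicit.
Unset Printing Implicit Defensive.

Import Order.TTheory GRing.Theory Num.Theory.

Section Arborescence.

(* Multigraphs: the contracted digraph of the algorithm has parallel edges. *)
Variables (T Ed : finType) (src tgt : Ed -> T).

Definition reachable (F : {set Ed}) (x y : T) : bool :=
  connect [rel a b | [exists e in F, (src e == a) && (tgt e == b)]] x y.

Definition arborescence (U : {set T}) (F : {set Ed}) (r : T) (A : {set Ed}) :
    bool :=
  [&& A \subset F,
      [forall x in U, #|[set e in A | tgt e == x]| == (x != r)] &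
      [forall x in U, reachable A r x]].

End Arborescence.

Definition total_preorder_on (T : finType) (S : {set T}) (R : rel T) : Prop :=
  [/\ {in S, reflexive R}, {in S & &, transitive R} & {in S &, total R}].

(* The vertices of D are [option V], [None] being the root r.  No edge of D
   enters r, so an edge is a pair (tail, head) with head in V. *)
Notation edge V := (option V * V)%type.

Section RootedDigraph.

Variables (V : finType) (g : rel V) (pref : V -> rel (edge V)) (w : V -> nat).

Implicit Types (X C : {set V}) (F A : {set edge V}) (e f : edge V) (u v s : V).

Definition etail e : option V := e.1.
Definition ehead e : option V := Some e.2.

Definition edges : {set edge V} :=
  [set e | if e.1 is Some u then g u e.2 else true].

Definition tail_in X e : bool := if e.1 is Some u then u \in X else false.

Definition entering X : {set edge V} :=
  [set e in edges | (e.2 \in X) && ~~ tail_in X e].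

Definition induced X : {set edge V} :=
  [set e in edges | (e.2 \in X) && tail_in X e].

(* [pref v e f] is "f has at least the priority of e at v". *)
Definition dominates v f e : bool := pref v e f && ~~ pref v f e.

Definition root_least : Prop :=
  forall u v, g u v -> dominates v (Some u, v) (None, v).

Definition r_arborescence A : bool :=
  arborescence etail ehead [set: option V] edges None A.

(* The edge A(v); the default value is never used for an r-arborescence. *)
Definition in_edge A v : edge V := odflt (None, v) [pick e in A | e.2 == v].

Definition Delta A A' : int :=
  (\sum_(v | dominates v (in_edge A v) (in_edge A' v)) (w v)%:Z
   - \sum_(v | dominates v (in_edge A' v) (in_edge A v)) (w v)%:Z)%R.

Definition more_popular A A' : bool := (0 < Delta A A')%R.

Definition popular A : Prop :=
  r_arborescence A /\
  forall A', r_arborescence A' -> ~~ more_popular A' A.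

Definition safe X : {set edge V} :=
  [set e in induced X |
    [forall f in induced X, (f.2 == e.2) ==> pref e.2 f e] &&
    [forall f in entering X, (f.2 == e.2) ==> dominates e.2 e f]].

Definition safe_reach X u v : bool :=
  reachable etail ehead (safe X) (Some u) (Some v).

Definition reaches_all v X : bool := [forall x in X, safe_reach X v x].

Fixpoint shrink v (i : nat) : {set V} :=
  if i is j.+1 then [set x in shrink v j | safe_reach (shrink v j) v x]
  else [set: V].

Lemma shrink_terminates v : exists i, reaches_all v (shrink v i).
Proof.
have [i Hi | H] := pickP (fun i : 'I_#|V|.+1 => reaches_all v (shrink v i)).
  by exists i.
suff Hc i : i <= #|V|.+1 -> #|shrink v i| + i <= #|V|.
  by have := Hc #|V|.+1 (leqnn _); rewrite addnS ltnNge leq_addl.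
elim: i => [_|i IHi Hi]; first by rewrite addn0 max_card.
apply: leq_trans (IHi (ltnW Hi)); rewrite addnS -addSn leq_add2r /=.
apply: proper_card; rewrite properE; apply/andP; split.
  by apply/subsetP => x; rewrite inE => /andP[].
have /negbT := H (Ordinal Hi); rewrite /reaches_all negb_forall /=.
case/existsP => x; rewrite negb_imply => /andP[xX nx].
by apply/subsetPn; exists x => //; rewrite inE xX (negbTE nx).
Qed.

(* The loop stops at the first i for which v reaches all of [shrink v i]. *)
Definition limit_set v : {set V} := shrink v (ex_minn (shrink_terminates v)).

Definition maximal_sets : {set {set V}} :=
  [set X | maxset (fun Y => Y \in [set limit_set v | v : V]) X].

Definition sccs X : {set {set V}} :=
  [set [set y in X | safe_reach X x y && safe_reach X y x] | x in X].

Definition source_scc X : {set V} :=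
  odflt set0 [pick C in sccs X | [disjoint safe X & entering C]].

Definition min_vertices X : {set V} :=
  [set v in source_scc X | [forall u in source_scc X, w v <= w u]].

Definition condC X v : bool :=
  [exists s in X :\: source_scc X,
    [exists f in (induced X :\: safe X) :&: entering [set v],
      [&& w s < w v,
          reachable etail ehead (f |: safe X) (Some s) (Some v) &
          [forall e in entering [set v] :&: entering X, dominates v f e]]]].

Definition step3_fails : bool :=
  [exists X in maximal_sets, [forall v in min_vertices X, condC X v]].

(* Minimum-weight vertices through which a block may be entered.  Admitting all of
   [min_vertices X] is too liberal: let V = {a, b, s} with weights 3, 3, 2 and
   preferences (b,a) > (s,a) > (r,a) at a, (a,b) > (r,b) at b and
   (b,s) > (r,s) at s.  The only block is V, with source component {a, b}; a
   satisfies [condC] and b does not.  Entering V through a gives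
   {(r,a), (a,b), (b,s)}, which loses to {(r,s), (s,a), (a,b)}, whereas
   {(r,b), (b,a), (b,s)} is popular. *)
Definition entry_vertices X : {set V} :=
  [set v in min_vertices X | ~~ condC X v].

(* An edge of the contracted digraph is represented by the edge of D that it
   comes from; its ends are given by [ctail] and [chead], [None] being r. *)
Definition contracted_edges (entry : {set V} -> {set V}) : {set edge V} :=
  [set e in edges |
    [exists X in maximal_sets,
      [&& e.2 \in entry X, ~~ tail_in X e &
          [forall f in entering X, (f.2 == e.2) ==> ~~ dominates e.2 f e]]]].

Definition ctail e : option {set V} := omap (pblock maximal_sets) e.1.
Definition chead e : option {set V} := Some (pblock maximal_sets e.2).

Definition contracted_arborescence (entry : {set V} -> {set V}) A : bool :=
  arborescence ctail chead (None |: (Some @: maximal_sets))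
    (contracted_edges entry) None A.

Definition expand_roots A : {set V} :=
  [set v | (2 <= #|limit_set v|) && (entering [set v] :&: A != set0)].

(* Possible results of the algorithm, [None] being the answer
   "No popular arborescence in D"; the arborescences of the last step are
   chosen arbitrarily. *)
Inductive algorithm_returns (entry : {set V} -> {set V}) :
    option {set edge V} -> Prop :=
| ReturnNoStep3 :
    step3_fails -> algorithm_returns entry None
| ReturnNoStep4 :
    ~~ step3_fails ->
    (forall A, ~~ contracted_arborescence entry A) ->
    algorithm_returns entry None
| ReturnArborescence (A : {set edge V}) (B : V -> {set edge V}) :
    ~~ step3_fails ->
    contracted_arborescence entry A ->
    (forall v, v \in expand_roots A ->
       arborescence etail ehead (Some @: limit_set v) (safe (limit_set v))
         (Some v) (B v)) ->
    algorithm_returns entry (Some (A :|: \bigcup_(v in expand_roots A) B v)).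

End RootedDigraph.

(* Main.v *)
Require Import Defs.
From mathcomp Require Import all_boot all_order all_algebra.

Set Implicit Arguments.
Unset Strict Implicit.
Unset Printing Implicit Defensive.

Import Order.TTheory GRing.Theory Num.Theory.

(** Everything rests on one exchange principle ([popular_exchange]): if a set
    [F] of edges reaches every vertex from the root, it contains an
    arborescence, so a popular [A] cannot let some vertices gain in [F] more
    weight than the others lose.  This replaces the dual certificates given by
    weighted arborescence duality; no linear programming is involved.

    Let [A] be popular and [b] a vertex.  An edge is improving for [b] if it
    has at least the priority of the edge of [A] with the same head, strictly
    more when this head is [b].  Let [Y] be the set of the vertices that reach
    [b] by improving edges.  The root does not reach [b] in this way, because
    [b] alone would gain ([improving_root]).  Hence the edges of [A] into the
    vertices of [Y] other than [b] start in [Y] and dominate all edges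
    entering [Y].  They are also best among the edges inside [Y]: if [u] had a
    better edge from [p] in [Y], hanging [p] on the root would let [u] and [b]
    gain and only [p] lose, against [w p < w b + w u] ([improving_best]; this
    is where the condition on the weights enters).  So these edges are safe in
    [Y], and [Y] lies inside [limit_set b], the largest set that [b] spans by
    safe edges ([improving_limit], [limit_set_largest]).

    The maximal sets, or blocks, partition the vertices because the limit sets
    are laminar ([limit_set_laminar]).  In a block [X], take a vertex [b] of
    the source component at least depth in [A].  If some edge of [A] into
    [X :\ b] were unsafe, take the first head [c] of such an edge on a safe path
    from [b]; then [b] reaches [c] by improving edges for [c], so [c] spans [X]
    as well and lies above [b] in [A], a contradiction ([popular_block]).  So
    [A] enters [X] only at [b] and is safe elsewhere in [X].  Exchanges that hang
    [X] on the root by another vertex show that [b] has minimum weight in the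
    source component and that the exclusion condition fails for [b]
    ([popular_min_vertex], [popular_not_condC]).  Therefore the edges of [A]
    between blocks form an arborescence of the contracted digraph, and the
    algorithm does not fail ([structured_contracted]).

    Conversely every output has this block structure ([out_structured]), which
    alone implies popularity ([structured_popular]).  Indeed, against another
    arborescence the votes can be compared block by block.  In a block only the
    entry vertex [b] can lose its vote, to an edge [f] from inside the block;
    the other arborescence then enters the block at some [s <> b], which is
    worse off.  Two such vertices outweigh [b], and so does one of weight at
    least [w b].  What remains is a single vertex [s] lighter than [b] from
    which safe edges and [f] lead to [b], and this is the exclusion condition
    for [b]. *)

(** * Reachability and spanning arborescences *)

Section Reachability.

Variables (T Ed : finType) (src tgt : Ed -> T).
Implicit Types (F A : {set Ed}) (U : {set T}).

Lemma reachable_refl F x : reachable src tgt F x x.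
Proof. exact: connect0. Qed.

Lemma reachable_step F x e :
  e \in F -> reachable src tgt F x (src e) -> reachable src tgt F x (tgt e).
Proof.
move=> eF /connect_trans; apply; apply: connect1 => /=.
by apply/existsP; exists e; rewrite eF !eqxx.
Qed.

Lemma reachable_trans F : transitive (reachable src tgt F).
Proof. exact: connect_trans. Qed.

Lemma reachable_ind F x (P : T -> Prop) :
    P x -> (forall e, e \in F -> P (src e) -> P (tgt e)) ->
  forall y, reachable src tgt F x y -> P y.
Proof.
move=> Px Pstep y /connectP[p]; elim: p x Px => [|z p IHp] x Px /=.
  by move=> _ ->.
case/andP=> /existsP[e /and3P[eF /eqP ex /eqP ez]] pth ylast.
by apply: IHp pth ylast; rewrite -ez; apply: Pstep => //; rewrite ex.
Qed.

Lemma reachable_last F x y : reachable src tgt F x y ->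
  x = y \/ exists e, [/\ e \in F, tgt e = y & reachable src tgt F x (src e)].
Proof.
have step z : z = x \/ reachable src tgt F x z -> reachable src tgt F x z.
  by case=> // ->; apply: reachable_refl.
move=> xy; suff [_] : reachable src tgt F x y /\ (x = y \/
  exists e, [/\ e \in F, tgt e = y & reachable src tgt F x (src e)]) by [].
move: y xy; apply: reachable_ind; first by split; [apply: reachable_refl|left].
by move=> e eF [xe _]; split; [apply: reachable_step|right; exists e].
Qed.

(** Used after an exchange: an old path survives as soon as the heads of its
    discarded edges are reached in another way. *)
Lemma reachable_override F F' x z :
    reachable src tgt F' z x ->
    (forall e, e \in F -> e \in F' \/ reachable src tgt F' z (tgt e)) ->
  forall y, reachable src tgt F x y -> reachable src tgt F' z y.
Proof.
move=> zx FF' y; move: y; apply: reachable_ind => // e /FF'[eF' | //].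
exact: reachable_step.
Qed.

(** A maximal subset of [F] that looks like an out-tree around [r] reaches
    everything that [F] reaches: otherwise an edge leaving its reach could be
    added. *)
Lemma spanning_arborescence U F r :
    (forall x, x \in U -> reachable src tgt F r x) ->
  exists A, arborescence src tgt U F r A.
Proof.
move=> reachU.
pose tree A := [&& A \subset F,
  [forall x, #|[set e in A | tgt e == x]| <= (x != r)] &
  [forall e in A, reachable src tgt A r (tgt e)]].
have tree0 : tree set0.
  apply/and3P; split; [exact: sub0set| |].
    by apply/forallP=> x; rewrite eq_card0 // => e; rewrite !inE.
  by apply/forall_inP=> x; rewrite inE.
have [A /maxsetP[/and3P[AF /forallP degA /forall_inP reachA] maxA] _] :=
  maxset_exists tree0.
have spanA x : reachable src tgt F r x -> reachable src tgt A r x.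
  move: x; apply: reachable_ind => [|e eF rs]; first exact: reachable_refl.
  case: (boolP (reachable src tgt A r (tgt e))) => // nr.
  have noA e' : e' \in A -> tgt e' != tgt e.
    by move=> /reachA; apply: contraTneq => ->.
  have AsubA' : A \subset e |: A by apply: subsetUr.
  have up y : reachable src tgt A r y -> reachable src tgt (e |: A) r y.
    apply: reachable_override; first exact: reachable_refl.
    by move=> e' e'A; left; apply: (subsetP AsubA').
  have re : reachable src tgt (e |: A) r (tgt e).
    by apply: reachable_step (up _ rs); apply: setU11.
  suff /maxA/(_ AsubA') eA : tree (e |: A).
    by have := setU11 e A; rewrite eA => /noA; rewrite eqxx.
  apply/and3P; split.
  - by rewrite subUset sub1set eF.
  - apply/forallP => x; have [<-|ne] := eqVneq (tgt e) x.
      rewrite (_ : tgt e != r); last first.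
        by apply: contraNneq nr => ->; apply: reachable_refl.
      rewrite (leq_trans (subset_leq_card _) (_ : #|[set e]| <= _)) ?cards1 //.
      apply/subsetP => e'; rewrite !inE => /andP[/orP[//|/noA]] + /eqP te.
      by rewrite te eqxx.
    apply: leq_trans (degA x); apply/subset_leq_card/subsetP => e'.
    by rewrite !inE => /andP[/orP[/eqP->|->] //]; rewrite (negbTE ne).
  - apply/forall_inP => e'; rewrite in_setU1 => /orP[/eqP-> //|e'A].
    exact/up/reachA.
exists A; apply/and3P; split=> //; apply/forall_inP => x /reachU/spanA // rx.
rewrite eqn_leq degA /=; have [//|ne] := eqVneq x r.
case: (reachable_last rx) => [rE|[e [eA te _]]]; first by rewrite rE eqxx in ne.
by rewrite card_gt0; apply/set0Pn; exists e; rewrite inE eA te eqxx.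
Qed.

End Reachability.

(** * Preferences and safe edges *)

Section Preferences.

Variables (V : finType) (g : rel V) (pref : V -> rel (edge V)).
Hypothesis g_loopless : irreflexive g.
Hypothesis pref_preorder : forall v : V,
  total_preorder_on (entering g [set v]) (pref v).
Implicit Types (X Y : {set V}) (e f h : edge V) (u v x : V).

Lemma tail_inP X e : reflect (exists2 u, u \in X & e.1 = Some u) (tail_in X e).
Proof.
case: e => [[u|] v] /=; last by constructor=> -[].
by apply: (iffP idP) => [uX|[_ uX [->]] //]; exists u.
Qed.

Lemma in_entering X e :
  (e \in entering g X) = [&& e \in edges g, e.2 \in X & ~~ tail_in X e].
Proof. by rewrite [LHS]inE. Qed.

Lemma in_induced X e :
  (e \in induced g X) = [&& e \in edges g, e.2 \in X & tail_in X e].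
Proof. by rewrite [LHS]inE. Qed.

Lemma entering_head e : e \in edges g -> e \in entering g [set e.2].
Proof.
move=> eE; rewrite inE eE set11 /=; case: e eE => [[u|] v] //.
rewrite inE /= => guv; apply: contraTN guv; rewrite /tail_in /= inE => /eqP->.
by rewrite g_loopless.
Qed.

Lemma safeP X e :
  reflect [/\ e \in edges g, e.2 \in X, tail_in X e,
              forall f, f \in induced g X -> f.2 = e.2 -> pref e.2 f e &
              forall f, f \in entering g X -> f.2 = e.2 -> dominates pref e.2 e f]
          (e \in safe g pref X).
Proof.
rewrite [e \in safe g pref X]inE in_induced -!andbA.
apply: (iffP and5P) => -[eE eX teX].
  move=> /forall_inP h1 /forall_inP h2; split=> // f fX /eqP fe.
    exact: implyP (h1 f fX) fe.
  exact: implyP (h2 f fX) fe.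
move=> h1 h2; split=> //; apply/forall_inP => f fX; apply/implyP => /eqP.
  exact: h1.
exact: h2.
Qed.

Lemma safe_edges X e : e \in safe g pref X -> e \in edges g.
Proof. by case/safeP. Qed.

Lemma entering_or_induced X e : e \in edges g -> e.2 \in X ->
  e \in entering g X \/ e \in induced g X.
Proof.
by move=> eE eX; rewrite in_entering in_induced eE eX; case: tail_in; [right|left].
Qed.

Section Preorder.

Variables (v : V) (e f h : edge V).
Hypotheses (eE : e \in edges g) (fE : f \in edges g) (hE : h \in edges g).
Hypotheses (ev : e.2 = v) (fv : f.2 = v) (hv : h.2 = v).

Let e_v : e \in entering g [set v]. Proof. by rewrite -ev entering_head. Qed.
Let f_v : f \in entering g [set v]. Proof. by rewrite -fv entering_head. Qed.
Let h_v : h \in entering g [set v]. Proof. by rewrite -hv entering_head. Qed.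

Lemma pref_refl : pref v e e.
Proof. by case: (pref_preorder v) => refl _ _; apply: refl. Qed.

Lemma pref_trans : pref v e f -> pref v f h -> pref v e h.
Proof. by case: (pref_preorder v) => _ trans _; apply: trans. Qed.

Lemma not_dominatesE : ~~ dominates pref v f e = pref v f e.
Proof.
rewrite /dominates negb_and negbK; case: (pref_preorder v) => _ _ /(_ e f e_v f_v).
by case: (pref v e f).
Qed.

Lemma not_prefE : ~~ pref v f e = dominates pref v f e.
Proof. by rewrite -not_dominatesE negbK. Qed.

End Preorder.

Lemma dominates_irrefl v e : ~~ dominates pref v e e.
Proof. by rewrite /dominates andbN. Qed.

Lemma dominatesW v f e : dominates pref v f e -> pref v e f.
Proof. by case/andP. Qed.

Lemma dominatesNpref v f e : dominates pref v f e -> pref v f e = false.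
Proof. by case/andP=> _ /negbTE. Qed.

Lemma dominates_pref_trans v e f h :
    e \in edges g -> f \in edges g -> h \in edges g ->
    e.2 = v -> f.2 = v -> h.2 = v ->
  pref v e f -> dominates pref v h f -> dominates pref v h e.
Proof.
move=> eE fE hE ev fv hv ef hf; rewrite -not_prefE //.
by apply: contraFN (dominatesNpref hf) => he; apply: (pref_trans hE eE fE).
Qed.

Lemma pref_dominates_trans v e f h :
    e \in edges g -> f \in edges g -> h \in edges g ->
    e.2 = v -> f.2 = v -> h.2 = v ->
  dominates pref v f e -> pref v f h -> dominates pref v h e.
Proof.
move=> eE fE hE ev fv hv fe fh; rewrite -not_prefE //.
by apply: contraFN (dominatesNpref fe) => he; apply: (pref_trans fE hE eE).
Qed.

Lemma safe_ge X e f :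
    e \in safe g pref X -> f \in edges g -> f.2 = e.2 -> pref e.2 e f ->
  f \in safe g pref X.
Proof.
move=> eS fE fe ef; have [eE eX _ he1 he2] := safeP _ _ eS.
have fX : f \in induced g X.
  case: (entering_or_induced fE (_ : f.2 \in X)) => //; first by rewrite fe.
  by move=> /he2/(_ fe)/dominatesNpref; rewrite ef.
have tfX : tail_in X f by move: fX; rewrite inE => /and3P[].
apply/safeP; rewrite fe; split=> // h hX hfe.
  apply: pref_trans (he1 h hX hfe) ef => //.
  by move: hX; rewrite inE => /andP[].
have hE : h \in edges g by move: hX; rewrite inE => /andP[].
exact: pref_dominates_trans (he2 h hX hfe) ef.
Qed.

(** The two clauses of safety concern edges inside the set and edges entering
    it, and together these are all the edges with a given head in the set. *)
Lemma safe_pref X e f : e \in safe g pref X -> f \in edges g -> f.2 = e.2 ->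
  pref e.2 f e.
Proof.
move=> eS fE fe; have [eE eX _ he1 he2] := safeP _ _ eS.
case: (entering_or_induced fE (_ : f.2 \in X)); rewrite ?fe // => fX.
  exact: dominatesW (he2 f fX fe).
exact: he1.
Qed.

Lemma safe_dominates X e f : e \in safe g pref X -> f \in edges g ->
  f.2 = e.2 -> f \notin safe g pref X -> dominates pref e.2 e f.
Proof.
move=> eS fE fe; apply: contraR; rewrite not_dominatesE ?(safe_edges eS) //.
exact: safe_ge.
Qed.

End Preferences.

(** * Limit sets, blocks and source components *)

Section LimitSets.

Variables (V : finType) (g : rel V) (pref : V -> rel (edge V)).
Implicit Types (X Y : {set V}) (e f h : edge V) (u v x y : V).

Local Notation safe := (safe g pref).
Local Notation limit_set := (limit_set g pref).
Local Notation maximal_sets := (maximal_sets g pref).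
Local Notation source_scc := (source_scc g pref).
Local Notation reaches_all := (reaches_all g pref).
Local Notation safe_reach := (safe_reach g pref).

(** An edge inside [Y] with its head in [X] either lies inside [X] or enters
    [X], and a safe edge of [X] has priority over both kinds. *)
Lemma safe_mono X Y : X \subset Y -> safe X \subset safe Y.
Proof.
move=> XY; apply/subsetP => e /safeP[eE eX teX le dom]; apply/safeP.
have YX f : f \in edges g -> f.2 = e.2 -> ~~ tail_in X f -> f \in entering g X.
  by move=> fE fe tf; rewrite in_entering fE fe eX tf.
have tXY f : tail_in X f -> tail_in Y f.
  by case/tail_inP=> u uX fu; apply/tail_inP; exists u => //; apply: (subsetP XY).
split=> //; [exact: (subsetP XY)|exact: tXY|move=> f|move=> f].
- rewrite in_induced => /and3P[fE _ _] fe.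
  case: (boolP (tail_in X f)) => tf.
    by apply: le; rewrite // in_induced fE fe eX.
  by case/andP: (dom f (YX f fE fe tf) fe).
- rewrite in_entering => /and3P[fE _ tf] fe; apply: dom (fe); apply: YX => //.
  by apply: contra tf; apply: tXY.
Qed.

Lemma limit_set_reaches v : reaches_all v (limit_set v).
Proof. by rewrite /Defs.limit_set; case: ex_minnP. Qed.

Lemma limit_set_refl v : v \in limit_set v.
Proof.
rewrite /Defs.limit_set; case: ex_minnP => i _ _; elim: i => [|i IHi] /=.
  by rewrite inE.
by rewrite inE IHi; apply: reachable_refl.
Qed.

(** Safety is monotone in the set, so a set that one of its vertices spans by
    safe edges survives every round that this vertex survives.  Hence
    [limit_set v] is the largest set spanned from [v] by safe edges. *)
Lemma limit_set_largest u v Y :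
  v \in limit_set u -> reaches_all v Y -> Y \subset limit_set u.
Proof.
move=> + /forall_inP vY; rewrite /Defs.limit_set; case: ex_minnP => i _ _.
elim: i => [_|i IHi] /=; first exact: subsetT.
rewrite inE => /andP[/IHi YX uv]; apply/subsetP => y yY.
rewrite inE (subsetP YX) //=; apply: reachable_override (vY y yY) => // e eS.
by left; apply: (subsetP (safe_mono YX)).
Qed.

Lemma limit_setS u v : v \in limit_set u -> limit_set v \subset limit_set u.
Proof. by move=> vu; apply: limit_set_largest vu (limit_set_reaches v). Qed.

(** A safe path of [limit_set u] enters [limit_set v] only at [v].  At any
    other vertex, some safe edge [f] of [limit_set v] dominates the edge [e] of
    the path, as [e] enters [limit_set v], whereas [e], being safe in
    [limit_set u], has at least the priority of [f]. *)
Lemma limit_set_laminar u v x : x \in limit_set u -> x \in limit_set v ->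
  u \in limit_set v \/ v \in limit_set u.
Proof.
move=> xu xv; apply/orP; apply: contraLR xv; rewrite negb_or => /andP[uNv vNu].
have := forall_inP (limit_set_reaches u) x xu.
suff H z : reachable (@etail V) (@ehead V) (safe (limit_set u)) (Some u) z ->
  if z is Some y then y \notin limit_set v else true by exact: H.
move: z; apply: reachable_ind => // e eS; rewrite /ehead /etail => teNv.
have [eE eXu /tail_inP[p pXu ep] le dom] := safeP _ _ _ _ eS.
apply/negP => eXv.
have eEnt : e \in entering g (limit_set v).
  by rewrite inE eE eXv /=; apply/tail_inP => -[q qv]; rewrite ep => -[qp];
     rewrite ep qp qv in teNv.
have := forall_inP (limit_set_reaches v) _ eXv.
case/reachable_last => [[ve]|[f [fS [fe] _]]]; first by rewrite ve eXu in vNu.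
have [fE fXv tfv le' dom'] := safeP _ _ _ _ fS.
have /andP[_ nfe] : dominates pref e.2 f e by rewrite -fe; apply: dom'.
case: (@entering_or_induced _ g (limit_set u) f fE _); first by rewrite fe.
  by move=> /dom/(_ fe)/andP[+ _]; rewrite (negbTE nfe).
by move=> /le/(_ fe); rewrite (negbTE nfe).
Qed.

Lemma maximal_limit X : X \in maximal_sets -> exists u, X = limit_set u.
Proof. by rewrite inE => /maxsetp/imsetP[u _ ->]; exists u. Qed.

Lemma maximal_eq X v : X \in maximal_sets -> X \subset limit_set v ->
  limit_set v = X.
Proof. by rewrite inE => /maxsetP[_]; apply; apply: imset_f. Qed.

Lemma limit_set_sub_maximal v : exists2 X, X \in maximal_sets & limit_set v \subset X.
Proof.
have [|X maxX vX] := @maxset_exists _ (fun Y => Y \in [set limit_set v | v : V])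
  (limit_set v); first exact: imset_f.
by exists X; rewrite // inE.
Qed.

Lemma maximal_disjoint X Y x : X \in maximal_sets -> Y \in maximal_sets ->
  x \in X -> x \in Y -> X = Y.
Proof.
move=> maxX maxY; have [u Xu] := maximal_limit maxX.
have [v Yv] := maximal_limit maxY => xX xY.
have xu : x \in limit_set u by rewrite -Xu.
have xv : x \in limit_set v by rewrite -Yv.
have [uv|vu] := limit_set_laminar xu xv.
  by rewrite Yv; apply/esym/maximal_eq; rewrite // Xu; apply: limit_setS.
by rewrite Xu; apply: maximal_eq; rewrite // Yv; apply: limit_setS.
Qed.

Lemma trivIset_maximal : trivIset maximal_sets.
Proof.
apply/trivIsetP => X Y maxX maxY; apply: contraR => /pred0Pn[x /andP[xX xY]].
exact/eqP/(maximal_disjoint maxX maxY xX xY).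
Qed.

Lemma cover_maximal v : v \in cover maximal_sets.
Proof.
have [X maxX vX] := limit_set_sub_maximal v.
by apply/bigcupP; exists X => //; apply: (subsetP vX); apply: limit_set_refl.
Qed.

Local Notation block := (pblock maximal_sets).

Lemma block_max v : block v \in maximal_sets.
Proof. exact: pblock_mem (cover_maximal v). Qed.

Lemma block_mem v : v \in block v.
Proof. by rewrite mem_pblock cover_maximal. Qed.

Lemma blockE X v : X \in maximal_sets -> v \in X -> block v = X.
Proof. exact: def_pblock trivIset_maximal. Qed.

(** A vertex [u] spanning [X] reaches the source component, which no safe
    edge enters, so [u] belongs to it.  This also shows that exactly one
    component can be picked. *)
Lemma source_sccE X v : X \in maximal_sets ->
  (v \in source_scc X) = (v \in X) && reaches_all v X.
Proof.
case/maximal_limit=> u Xu.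
have uX : u \in X by rewrite Xu limit_set_refl.
have uall x : x \in X -> safe_reach X u x.
  by rewrite Xu; apply/forall_inP/limit_set_reaches.
have scc_u C x : C \in sccs g pref X -> [disjoint safe X & entering g C] ->
    x \in C -> u \in C.
  case/imsetP=> y yX -> disj; apply: contraTT => uC.
  suff H z : reachable (@etail V) (@ehead V) (safe X) (Some u) z ->
      if z is Some v then
        v \notin [set z in X | safe_reach X y z && safe_reach X z y]
      else true.
    case: (boolP (x \in X)) => xX; last by rewrite inE (negbTE xX).
    exact: H (uall x xX).
  move: z; apply: reachable_ind => // e eS; rewrite /etail /ehead => teC.
  apply/negP => eC; have /disjointFr/(_ eS) := disj.
  rewrite in_entering (safe_edges eS) eC /= => /negbFE/tail_inP[p pC ep].
  by rewrite ep pC in teC.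
have [C [Cscc Cdisj Cu]] : exists C, [/\ C \in sccs g pref X,
    [disjoint safe X & entering g C] & source_scc X = C].
  rewrite /Defs.source_scc; case: pickP => [C /andP[Cs Cd]|none] /=.
    by exists C.
  (* If nothing were picked, the component of [u] would still qualify. *)
  pose C := [set z in X | safe_reach X u z && safe_reach X z u].
  have := none C; rewrite imset_f //= => /negP[].
  apply/pred0P => e /=; apply/negP => /andP[eS].
  rewrite in_entering => /and3P[_ eC /negP[]].
  have [_ _ /tail_inP[p pX ep] _ _] := safeP _ _ _ _ eS.
  apply/tail_inP; exists p => //; rewrite inE pX uall //=.
  have pe : safe_reach X p e.2.
    by apply: (reachable_step eS); rewrite /etail ep; apply: reachable_refl.
  by move: eC; rewrite inE => /and3P[_ _]; apply: reachable_trans pe.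
rewrite Cu; have uC : u \in C.
  case/imsetP: (Cscc) => y yX CE; apply: (scc_u C y Cscc Cdisj).
  by rewrite CE inE yX /Defs.safe_reach !reachable_refl.
have [y yX CE] := imsetP Cscc; move: uC; rewrite CE !inE => /and3P[_ yu uy].
apply/and3P/andP => -[vX].
  move=> _ vy; split=> //; apply/forall_inP => x xX.
  exact: reachable_trans (reachable_trans vy yu) (uall x xX).
by move=> /forall_inP vall; split=> //;
  [apply: reachable_trans yu (uall v vX) | apply: vall].
Qed.

Lemma source_limit X b :
  X \in maximal_sets -> b \in source_scc X -> limit_set b = X.
Proof.
move=> maxX; rewrite source_sccE // => /andP[_ ball]; apply: maximal_eq => //.
exact: limit_set_largest (limit_set_refl b) ball.
Qed.

Lemma limit_source X b : X \in maximal_sets -> limit_set b = X ->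
  b \in source_scc X.
Proof.
by move=> maxX bX; rewrite source_sccE // -bX limit_set_refl limit_set_reaches.
Qed.

Lemma source_sub X b : X \in maximal_sets -> b \in source_scc X -> b \in X.
Proof. by move=> maxX; rewrite source_sccE // => /andP[]. Qed.

Lemma source_reaches X b :
  X \in maximal_sets -> b \in source_scc X -> reaches_all b X.
Proof. by move=> maxX; rewrite source_sccE // => /andP[]. Qed.

Lemma source_nonempty X : X \in maximal_sets -> exists b, b \in source_scc X.
Proof.
by move=> maxX; have [u Xu] := maximal_limit maxX; exists u; apply: limit_source.
Qed.

Lemma source_closed X e : X \in maximal_sets -> e \in safe X ->
  e.2 \in source_scc X -> tail_in (source_scc X) e.
Proof.
move=> maxX eS; rewrite source_sccE // => /andP[eX /forall_inP eall].
have [_ _ /tail_inP[p pX ep] _ _] := safeP _ _ _ _ eS.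
apply/tail_inP; exists p; rewrite // source_sccE // pX; apply/forall_inP => x xX.
apply: reachable_trans (eall x xX); apply: (reachable_step eS).
by rewrite /etail ep; apply: reachable_refl.
Qed.

End LimitSets.

(** * Arborescences as parent functions *)

Section Arborescences.

Variables (V : finType) (g : rel V) (A : {set edge V}).
Hypothesis arbA : r_arborescence g A.
Implicit Types (e : edge V) (v : V) (F : {set edge V}).

Local Notation reach := (reachable (@etail V) (@ehead V)).

Lemma in_edgeP v :
  [/\ in_edge A v \in A, in_edge A v \in edges g & (in_edge A v).2 = v].
Proof.
have /and3P[/subsetP AE /forall_inP /(_ (Some v)) deg _] := arbA.
rewrite /in_edge; case: pickP => [e /andP[eA /eqP]|none] /=.
  by move=> ev; split=> //; apply: AE.
move: deg; rewrite inE => /(_ isT); rewrite eq_card0 // => e.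
by rewrite inE; apply: none.
Qed.

Lemma in_edge_head v : (in_edge A v).2 = v. Proof. by case: (in_edgeP v). Qed.

Lemma in_edge_edges v : in_edge A v \in edges g.
Proof. by case: (in_edgeP v). Qed.

Lemma in_edge_uniq e : e \in A -> in_edge A e.2 = e.
Proof.
have /and3P[_ /forall_inP /(_ (Some e.2)) deg _] := arbA => eA.
move: deg; rewrite inE => /(_ isT)/cards1P[f fE].
have only e' : e' \in A -> e'.2 = e.2 -> e' = f.
  by move=> e'A e'e; apply/set1P; rewrite -fE inE e'A /ehead e'e eqxx.
have [a_in _ a_head] := in_edgeP e.2.
by rewrite (only _ a_in a_head) -(only e eA).
Qed.

Lemma arborescence_ind (P : option V -> Prop) :
    P None -> (forall v, P (in_edge A v).1 -> P (Some v)) ->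
  forall x, P x.
Proof.
move=> P0 Pstep; have /and3P[_ _ /forall_inP reachA] := arbA.
suff H y : reach A None y -> P y by move=> y; apply: H; apply: reachA; rewrite inE.
move: y; apply: reachable_ind => // e eA; rewrite /etail /ehead => Pe.
by apply: Pstep; rewrite in_edge_uniq.
Qed.

(** Depth in the tree; only its growth along edges matters, and it serves to
    compare ancestors with descendants and as an induction measure. *)
Lemma arborescence_depth :
  exists d : option V -> nat, forall v, d (in_edge A v).1 < d (Some v).
Proof.
pose up x := if x is Some v then (in_edge A v).1 else None.
have toroot x : exists n, iter n up x == None.
  move: x; apply: arborescence_ind => [|v [n]]; first by exists 0.
  by exists n.+1; rewrite iterSr.
exists (fun x => ex_minn (toroot x)) => v.
case: (ex_minnP (toroot (Some v))) => -[|n] // /eqP vn _; rewrite ltnS.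
by case: ex_minnP => m _; apply; rewrite -[(in_edge A v).1]/(up (Some v)) -iterSr vn.
Qed.

End Arborescences.

(** * Exchange arguments for a popular arborescence *)

Section PopularArborescence.

Variables (V : finType) (g : rel V) (pref : V -> rel (edge V)) (w : V -> nat).
Hypothesis g_loopless : irreflexive g.
Hypothesis pref_preorder : forall v : V,
  total_preorder_on (entering g [set v]) (pref v).
Hypothesis w_gt0 : forall v : V, 0 < w v.
Hypothesis w_sum : forall s t u : V, w u < w s + w t.
Variable A : {set edge V}.
Hypothesis popA : popular g pref w A.
Implicit Types (X Y : {set V}) (e f h : edge V) (u v b : V).
Implicit Types (F : {set edge V}).

Local Notation reach := (reachable (@etail V) (@ehead V)).
Local Notation safe := (safe g pref).
Local Notation limit_set := (limit_set g pref).
Local Notation maximal_sets := (maximal_sets g pref).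
Local Notation source_scc := (source_scc g pref).
Local Notation a := (in_edge A).

Let arbA : r_arborescence g A. Proof. by case: popA. Qed.
Let aE v : a v \in edges g. Proof. exact: (in_edge_edges arbA). Qed.
Let a_head v : (a v).2 = v. Proof. exact: (in_edge_head arbA). Qed.
Let root_edge v : (None, v) \in edges g. Proof. by rewrite inE. Qed.

(** Whichever arborescence is chosen inside [F], the vertices of [G] prefer it
    to [A] and at most those of [L] prefer [A]. *)
Lemma popular_exchange F (G L : {set V}) :
    F \subset edges g -> (forall x, reach F None x) ->
    (forall e, e \in F -> e.2 \notin L -> ~~ dominates pref e.2 (a e.2) e) ->
    (forall e, e \in F -> e.2 \in G -> dominates pref e.2 e (a e.2)) ->
  \sum_(v in G) w v <= \sum_(v in L) w v.
Proof.
move=> FE reachF los gain.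
have [A' treeA'] : exists A',
    arborescence (@etail V) (@ehead V) [set: option V] F None A'.
  by apply: spanning_arborescence => x _; apply: reachF.
have [/subsetP A'F deg' reach'] := and3P treeA'.
have arbA' : r_arborescence g A'.
  by apply/and3P; split=> //; apply: subset_trans FE; apply/subsetP.
have a'F v : in_edge A' v \in F.
  by apply: A'F; case: (in_edgeP arbA' v).
have a'_head v : (in_edge A' v).2 = v by apply: in_edge_head arbA' v.
case: popA => _ /(_ A' arbA').
rewrite /more_popular /Delta -!(big_morph Posz PoszD (erefl _)).
rewrite subr_gt0 ltz_nat -leqNgt => le; apply: leq_trans (leq_trans le _).
  rewrite big_mkcond [leqRHS]big_mkcond; apply: leq_sum => v _ /=.
  by case: ifP => // vG; have := gain _ (a'F v); rewrite a'_head => /(_ vG)->.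
rewrite big_mkcond [leqRHS]big_mkcond; apply: leq_sum => v _ /=.
case: (boolP (v \in L)) => vL; first by case: ifP.
by have := los _ (a'F v); rewrite a'_head => /(_ vL)/negbTE->.
Qed.

(** The set of vertices reaching [b] by these edges plays the part of the
    largest set that [A] enters at [b] in a dual certificate of popularity. *)
Definition improving b : {set edge V} :=
  [set e in edges g | if e.2 == b then dominates pref b e (a b)
                      else pref e.2 (a e.2) e].

Lemma improvingE b e : (e \in improving b) = (e \in edges g) &&
  (if e.2 == b then dominates pref b e (a b) else pref e.2 (a e.2) e).
Proof. by rewrite [LHS]inE. Qed.

Lemma in_edge_improving b v : v != b -> a v \in improving b.
Proof.
move=> vb; rewrite improvingE aE a_head (negbTE vb).
exact: (pref_refl g_loopless pref_preorder).
Qed.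

Lemma improving_no_loss b e :
  e \in improving b -> ~~ dominates pref e.2 (a e.2) e.
Proof.
rewrite improvingE => /andP[_]; case: eqP => [->|_] h; apply/negP => /andP[_].
  by rewrite (dominatesW h).
by rewrite h.
Qed.

(** Otherwise [improving b] reaches every vertex, since it contains all edges
    of [A] but the one into [b], and switching to it benefits [b] for free. *)
Lemma improving_root b : ~~ reach (improving b) None (Some b).
Proof.
apply/negP => rb; have := @popular_exchange (improving b) [set b] set0.
rewrite big_set1 big_set0 leqNgt w_gt0 => /(_ _ _ _ _)/notF; apply.
- by apply/subsetP => e; rewrite improvingE => /andP[].
- apply: (arborescence_ind arbA); first exact: reachable_refl.
  move=> v IHv; have [-> //|vb] := eqVneq v b.
  have := reachable_step (in_edge_improving vb) IHv.
  by rewrite /ehead a_head.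
- by move=> e eH _; apply: improving_no_loss eH.
- by move=> e + /set1P eb; rewrite improvingE eb eqxx => /andP[].
Qed.


Lemma reach_in_edge F v y : a v \in F -> reach F y (a v).1 -> reach F y (Some v).
Proof. by move=> aF /(reachable_step aF); rewrite /ehead a_head. Qed.

Lemma improving_pred b e : e \in improving b ->
    reach (improving b) (Some e.2) (Some b) ->
  exists2 p, e.1 = Some p & reach (improving b) (Some p) (Some b).
Proof.
move=> eH eb; have tb : reach (improving b) (etail e) (Some b).
  exact: reachable_trans (reachable_step eH (reachable_refl _ _ _ _)) eb.
move: tb; rewrite /etail; case: e.1 => [p|] pb; first by exists p.
by have := improving_root b; rewrite pb.
Qed.

Lemma improving_tail b u : reach (improving b) (Some u) (Some b) -> u != b ->
  exists2 p, (a u).1 = Some p & reach (improving b) (Some p) (Some b).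
Proof.
by move=> ub /in_edge_improving aH; apply: improving_pred; rewrite // a_head.
Qed.

(** Going up in [A] from a vertex that reaches [b] by improving edges, one
    stays among such vertices until [b] is met, as the root is not one. *)
Lemma improving_depth (d : option V -> nat) b u :
    (forall v, d (a v).1 < d (Some v)) ->
    reach (improving b) (Some u) (Some b) -> u != b ->
  d (Some b) < d (Some u).
Proof.
move=> dA; have [n] := ubnP (d (Some u)); elim: n u => // n IHn u ltn ub unb.
have [p ap pb] := improving_tail ub unb.
have pu : d (Some p) < d (Some u) by rewrite -ap.
have [<- //|pnb] := eqVneq p b; apply: ltn_trans (pu); apply: IHn => //.
exact: leq_trans pu _.
Qed.

(** The weight condition is used here: otherwise [p] could be hung on the root,
    after which [u] takes its better edge and, through improving edges, [b]
    gains as well, at the sole expense of [p].  When [p] is [b] itself, [u] is a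
    descendant of [b] in [A], and moving [u] below [b] costs nothing. *)
Lemma improving_best b p u :
    reach (improving b) (Some u) (Some b) -> u != b ->
    reach (improving b) (Some p) (Some b) -> (Some p, u) \in edges g ->
  pref u (Some p, u) (a u).
Proof.
move=> ub unb pb gE.
rewrite -(not_dominatesE g_loopless pref_preorder) //; apply/negP => better.
have pnu : p != u by apply: contraTneq gE => ->; rewrite inE /= g_loopless.
have [d dA] := arborescence_depth arbA.
have [pEb|pnb] := eqVneq p b.
  subst p; pose F := [set e in edges g | if e.2 == u then e == (Some b, u)
                                         else e == a e.2].
  have aF v : v != u -> a v \in F by move=> vu; rewrite inE aE a_head (negbTE vu) /=.
  have gF : (Some b, u) \in F by rewrite inE gE !eqxx.
  have := @popular_exchange F [set u] set0.
  rewrite big_set1 big_set0 leqNgt w_gt0 => /(_ _ _ _ _)/notF; apply.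
  - by apply/subsetP => e; rewrite inE => /andP[].
  (* Only the edge into [u] changes, so the vertices of smaller depth than [u],
     among them [b], are still reached. *)
  - have below n v : d (Some v) < n -> n <= d (Some u) -> reach F None (Some v).
      elim: n v => // n IHn v vn nu.
      have vu : v != u.
        by apply: contraTneq vn => ->; rewrite -leqNgt.
      apply: reach_in_edge (aF v vu) _; case E: (a v).1 => [q|]; last exact: reachable_refl.
      apply: IHn; last exact: ltnW.
      by rewrite -E; apply: leq_trans (dA v) _.
    have ru : reach F None (Some u).
      apply: (reachable_step gF); apply: (below (d (Some u))) => //.
      exact: improving_depth.
    apply: (arborescence_ind arbA); first exact: reachable_refl.
    move=> v IHv; have [-> //|vu] := eqVneq v u.
    exact: reach_in_edge (aF v vu) IHv.
  - move=> e; rewrite inE => /andP[_]; case: ifP => [/eqP eu /eqP -> _ /=|_ /eqP<- _].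
      by apply/negP => /andP[_]; rewrite (dominatesW better).
    exact: dominates_irrefl.
  - by move=> e + /set1P eu; rewrite inE eu eqxx => /andP[_ /eqP->].
pose F := [set e in edges g | if e.2 == p then e == (None, p)
           else if e.2 == u then e == (Some p, u) else e \in improving b].
have rF : (None, p) \in F by rewrite inE root_edge !eqxx.
have gF : (Some p, u) \in F by rewrite inE gE /= eq_sym (negbTE pnu) !eqxx.
have HF e : e \in improving b -> e.2 != p -> e.2 != u -> e \in F.
  move=> eH ep eu; rewrite inE (negbTE ep) (negbTE eu) eH andbT.
  by move: eH; rewrite improvingE => /andP[].
have rp : reach F None (Some p) := reachable_step rF (reachable_refl _ _ _ _).
have ru : reach F None (Some u) by apply: (reachable_step gF).
(* The improving path from [p] to [b] may pass through [p] or [u] again; their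
   edges in [F] differ from those of the path, but both are reached. *)
have rb : reach F None (Some b).
  apply: reachable_override (rp) _ _ pb => e eH.
  have [ep|ep] := eqVneq e.2 p; first by right; rewrite /ehead ep.
  have [eu|eu] := eqVneq e.2 u; first by right; rewrite /ehead eu.
  by left; apply: HF.
have := @popular_exchange F (b |: [set u]) [set p].
rewrite big_setU1 ?inE 1?eq_sym //= !big_set1 leqNgt w_sum => /(_ _ _ _ _)/notF.
apply.
- by apply/subsetP => e; rewrite inE => /andP[].
- apply: (arborescence_ind arbA); first exact: reachable_refl.
  move=> v IHv; have [-> //|vp] := eqVneq v p; have [-> //|vu] := eqVneq v u.
  have [-> //|vb] := eqVneq v b.
  have aF : a v \in F by apply: HF; rewrite ?a_head ?in_edge_improving.
  exact: reach_in_edge aF IHv.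
- move=> e eF /set1P/eqP/negbTE ep; move: eF; rewrite inE ep => /andP[_].
  case: ifP => [/eqP eu /eqP -> /=|_]; last exact: improving_no_loss.
  by apply/negP => /andP[_]; rewrite (dominatesW better).
- move=> e; rewrite inE => /andP[_ eF] /set2P[] eb; move: eF.
    rewrite eb eq_sym (negbTE pnb) eq_sym (negbTE unb) improvingE eb eqxx.
    by case/andP.
  by rewrite eb eq_sym (negbTE pnu) eqxx => /eqP->.
Qed.

(** The edges of [A] show that [b] spans, by safe edges, the set of all the
    vertices that reach it by improving edges. *)
Lemma improving_limit b v :
  reach (improving b) (Some v) (Some b) -> v \in limit_set b.
Proof.
pose Y := [set v | reach (improving b) (Some v) (Some b)].
have inY u : (u \in Y) = reach (improving b) (Some u) (Some b) by rewrite inE.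
rewrite -inY; move: v; apply/subsetP.
apply: limit_set_largest (limit_set_refl g pref b) _; apply/forall_inP.
have [d dA] := arborescence_depth arbA => v.
have [n] := ubnP (d (Some v)); elim: n v => // n IHn v vn vY.
have [->|vb] := eqVneq v b; first exact: reachable_refl.
have vb' := vY; rewrite inY in vb'.
have [p ap pb] := improving_tail vb' vb.
have aS : a v \in safe Y.
  apply/safeP; rewrite a_head aE; split=> //.
  - by apply/tail_inP; exists p; rewrite ?inY.
  - move=> -[[q|] x]; rewrite in_induced => /and3P[qE _]; rewrite /tail_in //= => qY xv.
    by subst x; apply: (@improving_best b); rewrite -?inY.
  - move=> e; rewrite in_entering => /and3P[eE eY teY] ev.
    rewrite -(not_prefE g_loopless pref_preorder) //.
    apply: contra teY => le; have eH : e \in improving b.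
      by rewrite improvingE eE ev (negbTE vb).
    have [|q eq qb] := improving_pred eH; first by rewrite ev -inY.
    by rewrite /tail_in eq inY.
apply: reach_in_edge aS _; rewrite ap; apply: IHn; last by rewrite inY.
by rewrite -ap; apply: leq_trans (dA v) _.
Qed.

Lemma better_edge_limit b e : e \in edges g -> e.2 = b ->
  dominates pref b e (a b) -> tail_in (limit_set b) e.
Proof.
move=> eE eb better.
have eH : e \in improving b by rewrite improvingE eE eb eqxx.
have [|p ep pb] := improving_pred eH; first by rewrite eb; apply: reachable_refl.
by apply/tail_inP; exists p; rewrite // improving_limit.
Qed.

(** The vertex of the source component at least depth in [A] is the only one
    that [A] does not serve by a safe edge.  If the first unserved vertex [c] on a
    safe path from [b] were not [b], the last edge of the path would be better
    for [c] than its edge in [A], and the earlier ones as good as those of [A].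
    So [b] would reach [c] by improving edges, which puts [b] in the limit set
    of [c] and strictly below [c]. *)
Lemma popular_block X : X \in maximal_sets -> exists b,
  [/\ b \in source_scc X, a b \in entering g X &
      forall u, u \in X -> u != b -> a u \in safe X].
Proof.
move=> maxX; have [d dA] := arborescence_depth arbA.
have [c cX] := source_nonempty maxX.
case: (arg_minnP (fun v => d (Some v)) cX) => b bX minb.
have bin := source_sub maxX bX.
have others u : u \in X -> u != b -> a u \in safe X.
  pose S := [set e in safe X | a e.2 \in safe X].
  have unsafe_top e : e \in safe X -> a e.2 \notin safe X ->
      reach S (Some b) e.1 -> e.2 = b.
    move=> eS aNS be; apply/eqP; apply: contraT => enb.
    have eH : e \in improving e.2.
      rewrite improvingE eqxx (safe_edges eS).
      exact: (safe_dominates g_loopless pref_preorder eS (aE _) (a_head _)).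
    have bH : reach (improving e.2) (Some b) (Some e.2).
      apply: (reachable_step eH).
      apply: reachable_override (reachable_refl _ _ _ _) _ _ be => f.
      rewrite inE => /andP[fS afS]; left.
      have fe : f.2 != e.2 by apply: contraNneq aNS => <-.
      rewrite improvingE (negbTE fe) (safe_edges fS).
      by apply: (safe_pref fS); rewrite ?a_head.
    (* The limit set of this head contains that of [b], which is maximal. *)
    suff /minb : e.2 \in source_scc X.
      by rewrite leqNgt (improving_depth dA bH) // eq_sym.
    apply: limit_source => //; apply: maximal_eq => //.
    by rewrite -(source_limit maxX bX) limit_setS // improving_limit.
  suff inS y : reach (safe X) (Some b) y -> reach S (Some b) y /\
      (if y is Some v then v != b -> a v \in safe X else true).
    move=> uX unb.
    by have [_ /(_ unb)] := inS _ (forall_inP (source_reaches maxX bX) u uX).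
  move: y; apply: reachable_ind; first by split; [apply: reachable_refl|rewrite eqxx].
  move=> e eS [be _].
  case: (boolP (a e.2 \in safe X)) => ae.
    by split=> //; apply: reachable_step be; rewrite inE eS.
  have eb := unsafe_top e eS ae be; rewrite /ehead eb eqxx.
  by split=> //; apply: reachable_refl.
exists b; split=> //; rewrite in_entering aE a_head bin; apply/negP => tb.
(* If no edge of [A] entered [X], then no vertex of [X] would be reached. *)
pose out (y : option V) : bool := if y is Some v then v \notin X else true.
suff allout y : out y by have := allout (Some b); rewrite /out bin.
move: y; apply: (arborescence_ind arbA) => // v.
apply: contraTT => /negPn vX; have : tail_in X (a v).
  by have [->|/(others v vX)/safeP[]] := eqVneq v b.
by case/tail_inP=> p pX ->; rewrite /out pX.
Qed.

Section Entry.

Variables (X : {set V}) (b : V).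
Hypotheses (maxX : X \in maximal_sets) (bX : b \in source_scc X).
Hypothesis (a_enters : a b \in entering g X).

Let b_in : b \in X. Proof. exact: source_sub bX. Qed.

(** An edge better than [a b] is improving for [b], so its tail lies in
    [limit_set b], which is [X]. *)
Lemma popular_undominated f : f \in entering g X -> f.2 = b ->
  ~~ dominates pref b f (a b).
Proof.
rewrite in_entering => /and3P[fE _ tf] fb; apply: contra tf.
by move=> /(better_edge_limit fE fb); rewrite (source_limit maxX bX).
Qed.

(** The exchange common to the next two lemmas: [X] is hung on the root by the
    vertex [s] and spanned by edges of [K], at the sole expense of [s]. *)
Lemma reroot (K : {set edge V}) s : s \in X -> s != b -> K \subset edges g ->
    (forall e, e \in K -> ~~ dominates pref e.2 (a e.2) e) ->
    (forall e, e \in K -> e.2 = b -> dominates pref b e (a b)) ->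
    (forall F, (None, s) \in F ->
       (forall e, e \in K -> e.2 \in X -> e.2 != s -> e \in F) ->
       forall v, v \in X -> reach F None (Some v)) ->
  w b <= w s.
Proof.
move=> sX sb /subsetP KE los gain reachX.
pose F := [set e in edges g | if e.2 \notin X then e == a e.2
                              else if e.2 == s then e == (None, s) else e \in K].
have rX v : v \in X -> reach F None (Some v).
  apply: reachX => [|e eK eX es]; rewrite inE; first by rewrite root_edge sX !eqxx.
  by rewrite KE // eX (negbTE es).
have := @popular_exchange F [set b] [set s]; rewrite !big_set1; apply.
- by apply/subsetP => e; rewrite inE => /andP[].
- apply: (arborescence_ind arbA); first exact: reachable_refl.
  move=> v IHv; case: (boolP (v \in X)) => vX; first exact: rX.
  by apply: reach_in_edge IHv; rewrite inE aE a_head vX eqxx.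
- move=> e eF /set1P/eqP/negbTE es; move: eF; rewrite inE es => /andP[_].
  by case: ifP => [_ /eqP<-|_ /los //]; apply: dominates_irrefl.
- move=> e eF /set1P eb; move: eF.
  by rewrite inE eb b_in /= eq_sym (negbTE sb) => /andP[_ /gain]; apply.
Qed.

Lemma safe_no_loss e : e \in safe X -> ~~ dominates pref e.2 (a e.2) e.
Proof.
by move=> eS; apply/negP => /andP[_]; rewrite (safe_pref eS) ?a_head.
Qed.

Lemma safe_gain e : e \in safe X -> e.2 = b -> dominates pref b e (a b).
Proof. by move=> /safeP[_ _ _ _ dom] eb; rewrite -eb dom ?eb ?a_head. Qed.

Lemma popular_min_vertex : b \in min_vertices g pref w X.
Proof.
rewrite inE bX; apply/forall_inP => x xX; have [-> //|xb] := eqVneq x b.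
apply: (@reroot (safe X)) => //; first exact: source_sub xX.
- by apply/subsetP => e /safe_edges.
- exact: safe_no_loss.
- exact: safe_gain.
move=> F rF SF v vX; have rx : reach F None (Some x).
  exact: (reachable_step rF (reachable_refl _ _ _ _)).
apply: reachable_override (rx) _ _ (forall_inP (source_reaches maxX xX) v vX) => e eS.
have [ex|ex] := eqVneq e.2 x; first by right; rewrite /ehead ex.
by left; apply: SF => //; case/safeP: eS.
Qed.

(** If the condition held, entering [X] at the lighter vertex [s] and giving
    [f] to [b] would make [b] gain more than [s] loses.  The edge [f] is the only
    way from [s] into the source component, so [b] is indeed reached through it. *)
Lemma popular_not_condC : ~~ condC g pref w X b.
Proof.
apply/negP => /exists_inP[s /setDP[sX sNsrc] /exists_inP[f]].
rewrite in_setI in_setD in_entering in_induced.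
case/andP=> /andP[_ /and3P[fE fX tfX]] /and3P[_ /set1P fb _].
case/and3P=> ws sb /forall_inP fdom.
have bs : s != b by apply: contraNneq sNsrc => ->.
have fgain : dominates pref b f (a b).
  by apply: fdom; rewrite in_setI a_enters -{2}(a_head b) (entering_head g_loopless).
suff : w b <= w s by rewrite leqNgt ws.
have KP e : e \in f |: [set e in safe X | e.2 != b] ->
    e = f \/ e \in safe X /\ e.2 != b.
  by rewrite in_setU1 inE => /orP[/eqP|/andP]; [left|right].
apply: (@reroot (f |: [set e in safe X | e.2 != b])) => //.
- by apply/subsetP => e /KP[-> //|[/safe_edges]].
- move=> e /KP[->|[eS _]]; last exact: safe_no_loss.
  by rewrite fb; apply/negP => /andP[_]; rewrite (dominatesW fgain).
- by move=> e /KP[-> //|[_ /eqP]].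
move=> F rF KF v vX; have rs : reach F None (Some s).
  exact: (reachable_step rF (reachable_refl _ _ _ _)).
have fF : f \in F by apply: KF; rewrite ?setU11 ?fb // eq_sym.
have SF e : e \in safe X -> e.2 != b -> e.2 != s -> e \in F.
  by move=> eS eb; apply: KF; [rewrite in_setU1 inE eS eb orbT|case/safeP: eS].
suff rb : reach F None (Some b).
  apply: reachable_override (rb) _ _ (forall_inP (source_reaches maxX bX) v vX) => e eS.
  have [eb|eb] := eqVneq e.2 b; first by right; rewrite /ehead eb.
  have [es|es] := eqVneq e.2 s; first by right; rewrite /ehead es.
  by left; apply: SF.
apply/negPn/negP => nb.
(* As long as [b] is not reached, a path from [s] stays outside the source
   component, and so never needs an edge into [b]. *)
pose out (y : option V) : bool := if y is Some u then u \notin source_scc X else true.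
suff inv y : reach (f |: safe X) (Some s) y -> out y /\ reach F None y.
  by have [] := inv _ sb; rewrite /out bX.
move: y; apply: reachable_ind => // e /setU1P[->|eS] [oe re].
  by case/negP: nb; have := reachable_step fF re; rewrite /ehead fb.
have eNsrc : e.2 \notin source_scc X.
  apply/negP => /(source_closed maxX eS)/tail_inP[p pX ep].
  by move: oe; rewrite /out /etail ep pX.
split=> //; have [es|es] := eqVneq e.2 s; first by rewrite /ehead es.
apply: reachable_step re; apply: SF => //.
by apply: contraNneq eNsrc => ->.
Qed.

Lemma popular_entry_vertex : b \in entry_vertices g pref w X.
Proof. by rewrite inE popular_min_vertex popular_not_condC. Qed.

End Entry.

End PopularArborescence.

(** * The algorithm on block-structured arborescences *)

Section Algorithm.

Variables (V : finType) (g : rel V) (pref : V -> rel (edge V)) (w : V -> nat).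
Hypothesis g_loopless : irreflexive g.
Hypothesis pref_preorder : forall v : V,
  total_preorder_on (entering g [set v]) (pref v).
Hypothesis w_sum : forall s t u : V, w u < w s + w t.
Implicit Types (X Y : {set V}) (e f h : edge V) (u v b : V).
Implicit Types (A C F : {set edge V}).

Local Notation reach := (reachable (@etail V) (@ehead V)).
Local Notation safe := (safe g pref).
Local Notation limit_set := (limit_set g pref).
Local Notation maximal_sets := (maximal_sets g pref).
Local Notation source_scc := (source_scc g pref).
Local Notation entry := (entry_vertices g pref w).
Local Notation block := (pblock maximal_sets).

(** What popular arborescences and outputs of the algorithm have in common;
    conversely it suffices for popularity. *)
Definition block_structured A : Prop := forall X, X \in maximal_sets ->
  exists b, [/\ b \in entry X, in_edge A b \in entering g X,
    forall f, f \in entering g X -> f.2 = b -> ~~ dominates pref b f (in_edge A b) &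
    forall u, u \in X -> u != b -> in_edge A u \in safe X].

Lemma entryP X b : b \in entry X ->
  [/\ b \in source_scc X, forall u, u \in source_scc X -> w b <= w u &
      ~~ condC g pref w X b].
Proof. by rewrite !inE => /andP[/andP[bX /forall_inP minb] nC]. Qed.

Lemma entry_sub X b : X \in maximal_sets -> b \in entry X -> b \in X.
Proof. by move=> maxX /entryP[bX _ _]; apply: source_sub bX. Qed.

(** Each block is entered by exactly one edge of [A], which is allowed in the
    contracted digraph; following [A] from the root visits every block. *)
Lemma structured_contracted A : r_arborescence g A -> block_structured A ->
  contracted_arborescence g pref entry
    [set e in A | e \in entering g (block e.2)].
Proof.
move=> arbA blkA; set C := [set e in A | _].
have CA e : e \in C -> [/\ e \in A, in_edge A e.2 = e & e \in entering g (block e.2)].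
  by rewrite inE => /andP[eA ent]; rewrite (in_edge_uniq arbA eA).
have Chead X b e : X \in maximal_sets ->
    (forall u, u \in X -> u != b -> in_edge A u \in safe X) ->
    e \in C -> e.2 \in X -> e.2 = b.
  move=> maxX safeA /CA[eA ae] + eX; rewrite (blockE maxX eX) => ent.
  apply/eqP; apply: contraT => /(safeA _ eX); rewrite ae => /safeP[_ _ te _ _].
  by move: ent; rewrite in_entering te !andbF.
apply/and3P; split.
- apply/subsetP => e eC; have [eA ae ent] := CA e eC.
  have [b [be entb undom safeA]] := blkA _ (block_max g pref e.2).
  have eb := Chead _ b e (block_max g pref e.2) safeA eC (block_mem g pref e.2).
  rewrite inE; apply/andP; split; first by move: ent; rewrite in_entering => /andP[].
  apply/exists_inP; exists (block e.2); first exact: block_max.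
  rewrite {1}eb be; move: (ent); rewrite in_entering => /and3P[_ _ ->] /=.
  apply/forall_inP => f fent; apply/implyP => /eqP fe.
  by rewrite eb -ae eb undom // fe.
- apply/forall_inP => -[X|] /=; last first.
    by move=> _; rewrite eq_card0 // => e; rewrite inE andbF.
  case/setU1P=> [//|/imsetP[Y maxX [->]]] {X}.
  have [b [be entb undom safeA]] := blkA _ maxX.
  have bX := entry_sub maxX be.
  suff -> : [set e in C | chead g pref e == Some Y] = [set in_edge A b] by rewrite cards1.
  apply/setP => e; rewrite in_set1 inE; apply/andP/eqP => [[eC /eqP[eY]]|->].
    have eX : e.2 \in Y by rewrite -eY block_mem.
    by have [_ <- _] := CA e eC; rewrite (Chead Y b e maxX safeA eC eX).
  have [abA _ ab_head] := in_edgeP arbA b.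
  by rewrite inE abA /chead ab_head (blockE maxX bX) entb eqxx.
- have reachC y : reachable (ctail g pref) (chead g pref) C None (omap block y).
    move: y; apply: (arborescence_ind arbA); first exact: reachable_refl.
    move=> v; have [avA avE av_head] := in_edgeP arbA v => IHv.
    case: (boolP (tail_in (block v) (in_edge A v))) => tv.
      have [p pv ap] := tail_inP _ _ tv.
      by move: IHv; rewrite ap /= (blockE (block_max g pref v) pv).
    have aC : in_edge A v \in C.
      by rewrite inE avA av_head in_entering avE av_head block_mem.
    by have := reachable_step aC IHv; rewrite /chead av_head.
  apply/forall_inP => x /setU1P[->|/imsetP[X maxX ->]]; first exact: reachable_refl.
  have [u Xu] := maximal_limit maxX.
  have uX : u \in X by rewrite Xu limit_set_refl.
  by have := reachC (Some u); rewrite /= (blockE maxX uX).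
Qed.

Section Output.

Variables (C : {set edge V}) (B : V -> {set edge V}).
Hypothesis treeC : contracted_arborescence g pref entry C.
Hypothesis treeB : forall v, v \in expand_roots g pref C ->
  arborescence (@etail V) (@ehead V) (Some @: limit_set v) (safe (limit_set v))
    (Some v) (B v).

Let out := C :|: \bigcup_(v in expand_roots g pref C) B v.

Lemma contracted_edgeP e : e \in C ->
  [/\ e \in edges g, e.2 \in entry (block e.2), e \in entering g (block e.2) &
      forall f, f \in entering g (block e.2) -> f.2 = e.2 ->
        ~~ dominates pref e.2 f e].
Proof.
have /and3P[/subsetP CE _ _] := treeC => /CE.
rewrite inE => /andP[eE /exists_inP[X maxX /and3P[eX te /forall_inP undom]]].
have eX' := entry_sub maxX eX.
rewrite (blockE maxX eX') in_entering eE eX' te; split=> // f fX /eqP fe.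
exact: implyP (undom f fX) fe.
Qed.

Lemma contracted_in X : X \in maximal_sets -> exists e,
  [/\ e \in C, block e.2 = X & forall f, f \in C -> f.2 \in X -> f = e].
Proof.
move=> maxX; have /and3P[_ /forall_inP /(_ (Some X)) deg _] := treeC.
move: deg; rewrite in_setU1 imset_f ?orbT // => /(_ isT)/cards1P[e eE].
have : e \in [set e] by apply: set11.
rewrite -eE inE => /andP[eC /eqP[eX]]; exists e; split=> // f fC fX.
by apply/set1P; rewrite -eE inE fC /chead (blockE maxX fX) eqxx.
Qed.

Lemma expand_rootP v : v \in expand_roots g pref C ->
  [/\ 2 <= #|block v|, limit_set v = block v & exists2 e, e \in C & e.2 = v].
Proof.
rewrite inE => /andP[card /set0Pn[e]]; rewrite in_setI in_entering.
case/andP=> /and3P[_ /set1P ev _] eC; have [_ + _ _] := contracted_edgeP eC.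
rewrite ev => /entryP[bX _ _].
by rewrite (source_limit (block_max g pref v) bX) in card *; split=> //; exists e.
Qed.

Lemma expand_root e : e \in C -> 2 <= #|block e.2| ->
  e.2 \in expand_roots g pref C.
Proof.
move=> eC card; have [eE /entryP[bX _ _] _ _] := contracted_edgeP eC.
rewrite inE (source_limit (block_max g pref _) bX) card /=; apply/set0Pn; exists e.
by rewrite in_setI eC (entering_head g_loopless).
Qed.

(** The trees added in the last step do not interfere: the root of each is the
    head of the unique contracted edge into its block, and its edges stay
    inside the block. *)
Lemma out_in X e u : X \in maximal_sets -> e \in C -> block e.2 = X -> u \in X ->
  [/\ u = e.2 -> [set f in out | f.2 == u] = [set e] &
      u != e.2 -> exists2 f, f \in safe X & [set f in out | f.2 == u] = [set f]].
Proof.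
move=> maxX eC eX uX; have eXin : e.2 \in X by rewrite -eX block_mem.
have [e0 [e0C e0X onlyC]] := contracted_in maxX.
have e_only f : f \in C -> f.2 \in X -> f = e.
  by move=> fC fX; rewrite (onlyC f fC fX) (onlyC e eC eXin).
have outP f : f \in out -> f.2 \in X ->
    f = e \/ [/\ e.2 \in expand_roots g pref C, f \in B e.2 & f \in safe X].
  case/setUP=> [fC fX|/bigcupP[v vexp fB] fX]; first by left; apply: e_only.
  have [_ vblk [e' e'C e'v]] := expand_rootP vexp.
  have /and3P[/subsetP/(_ f fB) fS _ _] := treeB vexp.
  rewrite vblk in fS; have [_ fv _ _ _] := safeP _ _ _ _ fS.
  have vX : block v = X.
    by rewrite -(blockE (block_max g pref v) fv) (blockE maxX fX).
  right; rewrite -(e_only e' e'C) ?e'v -?vX ?block_mem //.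
have degB v : e.2 \in expand_roots g pref C -> v \in X ->
    #|[set f in B e.2 | f.2 == v]| = (v != e.2).
  move=> eexp vX; have /and3P[_ /forall_inP deg _] := treeB eexp.
  have [_ elim _] := expand_rootP eexp.
  have := deg (Some v); rewrite elim eX imset_f // => /(_ isT)/eqP.
  by congr (_ = _).
split=> [ue|une].
  apply/setP => f; rewrite in_set1 inE; apply/andP/eqP => [[fout /eqP fu]|->].
    have [|//|[eexp fB _]] := outP f fout; first by rewrite fu.
    have /eqP := degB u eexp uX; rewrite -ue eqxx cards_eq0 => /eqP/setP/(_ f).
    by rewrite !inE -ue in fB *; rewrite fB fu eqxx.
  by rewrite inE eC ue.
have eexp : e.2 \in expand_roots g pref C.
  apply: expand_root => //; rewrite eX (cardD1 u) uX (cardD1 e.2) !inE eXin.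
  by rewrite eq_sym une.
have /eqP/cards1P[f fE] : #|[set f in B e.2 | f.2 == u]| = 1 by rewrite degB ?une.
have : f \in [set f] by apply: set11.
rewrite -fE inE => /andP[fB fu]; exists f.
  have /and3P[/subsetP/(_ f fB) fS _ _] := treeB eexp.
  by have [_ elim _] := expand_rootP eexp; rewrite elim eX in fS.
apply/setP => f'; rewrite -fE !inE; apply: andb_id2r => /eqP f'u.
apply/idP/idP => [f'out|f'B]; last first.
  by apply/orP; right; apply/bigcupP; exists e.2.
have [||f'e|[]//] := outP f'; [by rewrite inE|by rewrite f'u|].
by rewrite -f'u f'e eqxx in une.
Qed.

Lemma out_arborescence : r_arborescence g out.
Proof.
apply/and3P; split.
- apply/subsetP => e /setUP[/contracted_edgeP[] //|/bigcupP[v vexp eB]].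
  by have /and3P[/subsetP/(_ e eB)/safe_edges] := treeB vexp.
- apply/forall_inP => -[u|] _ /=; last first.
    by rewrite eq_card0 // => e; rewrite inE andbF.
  have [e [eC eX _]] := contracted_in (block_max g pref u).
  have [root others] := out_in (block_max g pref u) eC eX (block_mem g pref u).
  rewrite (_ : [set f in out | ehead f == Some u] = [set f in out | f.2 == u]) //.
  by have [/root->|/others[f _ ->]] := eqVneq u e.2; rewrite cards1.
have reachX (Y : option {set V}) : reachable (ctail g pref) (chead g pref) C None Y ->
    forall u, (if Y is Some X then u \in X else false) -> reach out None (Some u).
  move: Y; apply: reachable_ind => // e eC IHe u; rewrite /chead => uX.
  have eout : e \in out by rewrite inE eC.
  have re : reach out None (Some e.2).
    apply: (reachable_step eout); move: IHe; rewrite /ctail /etail.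
    case: e.1 => [p|] /=; last by move=> _; apply: reachable_refl.
    by apply; apply: block_mem.
  have [-> //|une] := eqVneq u e.2.
  have eexp : e.2 \in expand_roots g pref C.
    apply: expand_root => //; rewrite (cardD1 u) uX (cardD1 e.2) !inE block_mem.
    by rewrite eq_sym une.
  have [_ elim _] := expand_rootP eexp.
  have /and3P[_ _ /forall_inP/(_ (Some u))] := treeB eexp.
  rewrite elim imset_f // => /(_ isT); apply: reachable_override re _ _ => f fB.
  by left; rewrite inE; apply/orP; right; apply/bigcupP; exists e.2.
have /and3P[_ _ /forall_inP reachC] := treeC.
apply/forall_inP => -[u|] _; last exact: reachable_refl.
apply: (reachX (Some (block u))) (block_mem g pref u).
by apply: reachC; rewrite in_setU1 imset_f ?block_max ?orbT.
Qed.

Lemma out_structured : block_structured out.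
Proof.
move=> X maxX; have [e [eC eX _]] := contracted_in maxX.
have arbO := out_arborescence.
have in_out u f : [set f in out | f.2 == u] = [set f] -> in_edge out u = f.
  move=> fE; have : f \in [set f] by apply: set11.
  by rewrite -fE inE => /andP[fout /eqP<-]; apply: (in_edge_uniq arbO).
have eXin : e.2 \in X by rewrite -eX block_mem.
have [/(_ erefl)/in_out ae _] := out_in maxX eC eX eXin.
have [_ ent entX undom] := contracted_edgeP eC.
exists e.2; rewrite ae; rewrite eX in ent entX undom; split=> // u uX ue.
by have [_ /(_ ue)[f fS /in_out->]] := out_in maxX eC eX uX.
Qed.

End Output.


(** Only the entry vertex [b] can be better off in [A'], by an edge [f] from
    inside [X].  If the vertices that are worse off weighed less than [b], there
    would be just one of them, the vertex [s] where [A'] enters [X]; then [A']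
    leads from [s] to [b] by safe edges and [f], so that [condC] holds for [b]. *)
Lemma structured_block A A' X : r_arborescence g A -> block_structured A ->
    r_arborescence g A' -> X \in maximal_sets ->
  \sum_(v | dominates pref v (in_edge A' v) (in_edge A v) && (block v == X)) w v <=
  \sum_(v | dominates pref v (in_edge A v) (in_edge A' v) && (block v == X)) w v.
Proof.
move=> arbA blkA arbA' maxX; have [b [bent entb undom safeA]] := blkA X maxX.
have bX := entry_sub maxX bent; have [bsrc bmin nC] := entryP bent.
have aE v : in_edge A v \in edges g by apply: (in_edge_edges arbA).
have aH v : (in_edge A v).2 = v by apply: (in_edge_head arbA).
have a'E v : in_edge A' v \in edges g by apply: (in_edge_edges arbA').
have a'H v : (in_edge A' v).2 = v by apply: (in_edge_head arbA').
pose lose v := dominates pref v (in_edge A v) (in_edge A' v) && (block v == X).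
have win_b v : dominates pref v (in_edge A' v) (in_edge A v) -> block v = X -> v = b.
  move=> win vX; apply/eqP; apply: contraTT win => vb.
  have aS : in_edge A v \in safe X by apply: safeA; rewrite // -vX block_mem.
  have := safe_pref aS (a'E v); rewrite a'H aH => /(_ erefl) le.
  by apply/negP => /andP[_]; rewrite le.
case: (boolP (dominates pref b (in_edge A' b) (in_edge A b))) => [win|nwin]; last first.
  rewrite big_pred0 // => v; apply/negP => /andP[win /eqP vX].
  by rewrite -(win_b v win vX) win in nwin.
rewrite (big_pred1 b) => [|v /=]; last first.
  apply/andP/eqP => [[win_v /eqP vX]|->]; first exact: win_b.
  by split=> //; apply/eqP/blockE.
rewrite leqNgt; apply/negP => small.
have loseW v : lose v -> w v < w b.
  by move=> lv; apply: leq_ltn_trans small; rewrite (bigD1 v) //= leq_addr.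
have lose1 u v : lose u -> lose v -> u = v.
  move=> lu lv; apply/eqP; apply: contraT => uv.
  suff : w b < w b by rewrite ltnn.
  apply: ltn_trans (w_sum u v b) (leq_ltn_trans _ small).
  rewrite (bigD1 u) //= (bigD1 v) /=; last by rewrite -/(lose v) lv eq_sym uv.
  by rewrite addnA leq_addr.
have safe_or_lose v : v \in X -> v != b -> in_edge A' v \in safe X \/ lose v.
  move=> vX vb; case: (boolP (in_edge A' v \in safe X)) => a'S; first by left.
  right; rewrite /lose (blockE maxX vX) eqxx andbT.
  have := safe_dominates g_loopless pref_preorder (safeA v vX vb) (a'E v).
  by rewrite a'H aH; apply.
set f := in_edge A' b in win.
have fX : f \in induced g X.
  case: (@entering_or_induced _ g X f (a'E b)) => //; first by rewrite a'H.
  by move=> /undom/(_ (a'H b)); rewrite win.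
have escape (Y : {set V}) : b \in Y ->
    exists2 v, v \in Y & ~~ tail_in Y (in_edge A' v).
  move=> bY; apply/exists_inP; apply: contraT => /exists_inPn closed.
  pose outY (y : option V) : bool := if y is Some v then v \notin Y else true.
  suff allout y : outY y by have := allout (Some b); rewrite /outY bY.
  move: y; apply: (arborescence_ind arbA') => // v.
  apply: contraTT => /negPn/closed/negPn/tail_inP[p pY ->].
  by rewrite /outY pY.
have [s sX s_out] := escape X bX.
have sb : s != b.
  apply: contraNneq s_out => ->; by move: fX; rewrite in_induced => /and3P[].
have ls : lose s.
  by have [/safeP[_ _ ts]|//] := safe_or_lose s sX sb; rewrite ts in s_out.
have ws := loseW s ls.
have s_src : s \notin source_scc X.
  by apply: contraTN ws => /bmin; rewrite -leqNgt.
have others v : v \in X -> v != b -> v != s -> in_edge A' v \in safe X.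
  move=> vX vb vs; have [//|/lose1/(_ ls) E] := safe_or_lose v vX vb.
  by rewrite E eqxx in vs.
(* If [f] were safe, all edges of [A'] into the source component would be
   safe, hence start in it, and [A'] would never reach it. *)
have fNS : f \notin safe X.
  apply/negP => fS; have [v vsrc] := escape _ bsrc; apply/negP/negPn.
  apply: source_closed; rewrite // ?a'H //.
  have [->//|vb] := eqVneq v b; apply: others => //; first exact: source_sub vsrc.
  by apply: contraNneq s_src => <-.
case/negP: nC; apply/exists_inP; exists s; first by rewrite in_setD s_src.
apply/exists_inP; exists f.
  rewrite in_setI in_setD fNS fX /= -(a'H b).
  exact: (entering_head g_loopless (a'E b)).
apply/and3P; split=> //.
- pose P (y : option V) := if y is Some v then v \in X -> reach (f |: safe X) (Some s) y
                           else True.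
  suff allP y : P y by apply: (allP (Some b)).
  move: y; apply: (arborescence_ind arbA') => // v IHv vX.
  have [->|vs] := eqVneq v s; first exact: reachable_refl.
  have a'in : in_edge A' v \in f |: safe X.
    rewrite in_setU1; have [->|vb] := eqVneq v b; first by rewrite eqxx.
    by rewrite others ?orbT.
  have tv : tail_in X (in_edge A' v).
    case/setU1P: a'in => [->|/safeP[] //].
    by move: fX; rewrite in_induced => /and3P[].
  rewrite -(a'H v); apply: (reachable_step a'in); rewrite /etail.
  by case/tail_inP: tv IHv => p pX -> /=; apply.
- apply/forall_inP => e /setIP[/=]; rewrite in_entering => /and3P[eE /set1P eb _] eX.
  have := undom e eX eb; rewrite (not_dominatesE g_loopless pref_preorder) // => le.
  exact: (dominates_pref_trans g_loopless pref_preorder eE (aE b) (a'E b)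
    eb (aH b) (a'H b) le win).
Qed.

Lemma structured_popular A :
  r_arborescence g A -> block_structured A -> popular g pref w A.
Proof.
move=> arbA blkA; split=> // A' arbA'.
rewrite /more_popular /Delta -!(big_morph Posz PoszD (erefl _)).
rewrite subr_gt0 ltz_nat -leqNgt.
rewrite (partition_big block (mem maximal_sets)) => [|v _]; last exact: block_max.
rewrite [leqRHS](partition_big block (mem maximal_sets)) => [|v _]; last exact: block_max.
by apply: leq_sum => X maxX; apply: structured_block.
Qed.

Lemma popular_structured A : (forall v, 0 < w v) -> popular g pref w A ->
  block_structured A.
Proof.
move=> w_gt0 popA X maxX.
have [b [bX ab safeA]] := popular_block g_loopless pref_preorder w_gt0 w_sum popA maxX.
exists b; split=> //.
  exact: (popular_entry_vertex g_loopless popA).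
exact: (popular_undominated g_loopless pref_preorder w_gt0 w_sum popA maxX bX).
Qed.

End Algorithm.

(** * Correctness of the algorithm *)

Theorem theorem19 (V : finType) (g : rel V) (pref : V -> rel (edge V))
    (w : V -> nat)
    (g_loopless : irreflexive g)
    (pref_preorder : forall v : V,
       total_preorder_on (entering g [set v]) (pref v))
    (pref_root : root_least g pref)
    (w_gt0 : forall v : V, 0 < w v)
    (w_sum : forall s t u : V, w u < w s + w t)
    (has_popular : exists A : {set edge V}, popular g pref w A) :
  ((exists out : option {set edge V},
      algorithm_returns g pref w (entry_vertices g pref w) out) /\
   (forall out : option {set edge V},
      algorithm_returns g pref w (entry_vertices g pref w) out ->
      exists2 A : {set edge V}, out = Some A & popular g pref w A)) /\
  (~ algorithm_returns g pref w (min_vertices g pref w) None /\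
   (exists2 A : {set edge V},
      algorithm_returns g pref w (min_vertices g pref w) (Some A) &
      popular g pref w A)).
Proof.
have [A popA] := has_popular; have [arbA _] := popA.
have blkA := popular_structured g_loopless pref_preorder w_sum w_gt0 popA.
have step3 : ~~ step3_fails g pref w.
  apply/exists_inPn => X /blkA[b [bent _ _ _]].
  have [_ _ nC] := entryP bent; apply/negP => /forall_inP/(_ b)/implyP.
  by rewrite (negbTE nC) implybF => /negP[]; move: bent; rewrite inE => /andP[].
pose C := [set e in A | e \in entering g (pblock (maximal_sets g pref) e.2)].
have treeC : contracted_arborescence g pref (entry_vertices g pref w) C.
  exact: structured_contracted.
(* Admitting all minimum vertices only enlarges the contracted digraph. *)
have treeCmin : contracted_arborescence g pref (min_vertices g pref w) C.
  case/and3P: treeC => CE deg reachC; apply/and3P; split=> //.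
  apply: subset_trans CE _; apply/subsetP => e; rewrite !inE.
  case/andP=> -> /exists_inP[X maxX /andP[eX rest]]; apply/exists_inP.
  by exists X => //; rewrite rest andbT; move: eX; rewrite inE => /andP[].
pose spans v B := arborescence (@etail V) (@ehead V)
  (Some @: limit_set g pref v) (safe g pref (limit_set g pref v)) (Some v) B.
pose B v := odflt set0 [pick B | spans v B].
have treeB v : spans v (B v).
  rewrite /B; case: pickP => //= none.
  have [T treeT] : exists T, spans v T; last by have := none T; rewrite treeT.
  apply: spanning_arborescence => x /imsetP[u uX ->].
  exact: (forall_inP (limit_set_reaches g pref v)).
have output_popular C' B' :
    contracted_arborescence g pref (entry_vertices g pref w) C' ->
    (forall v, v \in expand_roots g pref C' -> spans v (B' v)) ->
  popular g pref w (C' :|: \bigcup_(v in expand_roots g pref C') B' v).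
  move=> treeC' treeB'; apply: structured_popular => //.
    exact: (out_arborescence g_loopless treeC').
  exact: (out_structured g_loopless treeC').
split; split.
- exists (Some (C :|: \bigcup_(v in expand_roots g pref C) B v)).
  by apply: ReturnArborescence => // v _; apply: treeB.
- move=> out ret; case: ret => [|_ /(_ C)|C' B' _ treeC' treeB'].
  + by rewrite (negbTE step3).
  + by rewrite treeC.
  + exists (C' :|: \bigcup_(v in expand_roots g pref C') B' v) => //.
    exact: output_popular.
- move: {-1}None (erefl (@None {set edge V})) => out noneE ret.
  case: ret noneE => [|_ /(_ C)|//]; first by rewrite (negbTE step3).
  by rewrite treeCmin.
- exists (C :|: \bigcup_(v in expand_roots g pref C) B v).
    by apply: ReturnArborescence => // v _; apply: treeB.
  by apply: output_popular => // v _; apply: treeB.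
Qed.
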